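(* Let $(X,T)$ be a dynamical system and let $\mu\in M(X)$. Then the following statements are equivalent: (1) $\mu$ is ergodic. (2) There exists $Y\in\mathcal{B}(X)$ with $\mu(Y)=1$ such that, for all $y\in Y$, $\frac{1}{n}\sum_{i=0}^{n-1}\delta_{T^{i}(y)}\to\mu$ in the weak*-topology as $n\to\infty$. (3) There exists $Y\in\mathcal{B}(X)$ with $\mu(Y)=1$ such that, for all $y\in Y$ and all $\varphi\in C(X)$, $\lim_{n\to\infty}\frac{1}{n}\sum_{i=0}^{n-1}\varphi\circ T^{i}(y)=\int_X\varphi\,\mathrm{d}\mu$. (4) For any $\varphi\in C(X)$ and any $\varepsilon>0$, $$\lim_{k\to\infty}\mu\left(\bigcup_{n=k}^{+\infty}\left\{x\in X:\left|\frac{1}{n}\sum_{i=0}^{n-1}\varphi\circ T^{i}(x)-\int_X\varphi\,\mathrm{d}\mu\right|>\varepsilon\right\}\right)=0.$$ (5) For any $\varphi\in C(X)$, $\frac{1}{n}\sum_{i=0}^{n-1}\varphi\circ T^{i}(x)\to\int_X\varphi\,\mathrm{d}\mu$ for $\mu$-almost every $x\in X$.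
   Context: A dynamical system is a pair $(X,T)$ where $X$ is a compact metric space and $T:X\to X$ is a continuous map. $\mathcal{B}(X)$ is the Borel $\sigma$-algebra of $X$; $M(X)$ is the set of Borel probability measures on $X$; $M(X,T)\subset M(X)$ is the set of $T$-invariant ones. $C(X)$ is the space of continuous complex-valued functions on $X$. $\delta_x$ is the Dirac measure at $x$. A measure $\mu\in M(X)$ is called ergodic if $\mu\in M(X,T)$ and every $B\in\mathcal{B}(X)$ with $T^{-1}(B)=B$ satisfies $\mu(B)\in\{0,1\}$. *)

(* Defs.v *)
From HB Require Import structures.
From mathcomp Require Import all_boot all_order all_algebra.
From mathcomp Require Import all_classical all_reals all_analysis.
From mathcomp Require Import complex.
Set Implicit Arguments.
Unset Strict Implicit.
Unset Printing Implicit Defensive.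
Import Order.TTheory GRing.Theory Num.Theory.
Import numFieldNormedType.Exports.
Local Open Scope classical_set_scope.
Local Open Scope complex_scope.
Local Open Scope ring_scope.

(* The base point is the inhabitant that measurable types require; it costs no
   generality, as a space that carries a probability measure is nonempty. *)
#[short(type="pmetricType")]
HB.structure Definition PointedMetric (K : numDomainType) :=
  {M of Metric K M & Pointed M}.

(* The topology of the modulus: balls of R[i]^o are {w | `|z - w| < e}, where a
   positive e : R[i] is necessarily a positive real. *)
HB.instance Definition _ (R : realType) := GRing.ComAlgebra.copy R[i] R[i]^o.
HB.instance Definition _ (R : realType) := Vector.copy R[i] R[i]^o.
HB.instance Definition _ (R : realType) := NormedModule.copy R[i] R[i]^o.
HB.instance Definition _ (R : realType) := Num.ClosedField.on R[i].

Notation borel X := (g_sigma_algebraType (@open X)).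

Section ergodic.
Context {R : realType} {X : pmetricType R}.
Implicit Types (T : X -> X) (mu : probability (borel X) R) (phi : X -> R[i]).

Definition invariant_measure T mu :=
  forall B : set (borel X), measurable B -> mu (T @^-1` B) = mu B.

Definition ergodic T mu :=
  invariant_measure T mu /\
  forall B : set (borel X), measurable B -> T @^-1` B = B ->
    mu B = 0%E \/ mu B = 1%E.

Definition cintegral mu phi : R[i] :=
  (\int[mu]_x complex.Re (phi x)) +i* (\int[mu]_x complex.Im (phi x)).

Definition birkhoff_avg T phi (n : nat) (x : X) : R[i] :=
  n%:R^-1 * \sum_(i < n) phi (iter i T x).

End ergodic.

Section empirical.
Context {R : realType} {X : pmetricType R} (T : X -> X) (y : X) (n : nat).

(* The average of n.+1, not n, Dirac masses, so that it is a probability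
   measure for every n. *)
Definition empirical : set (borel X) -> \bar R :=
  mscale (n.+1%:R^-1)%:nng
    (msum (fun i => dirac (iter i T y : borel X)) n.+1).

HB.instance Definition _ := Measure.on empirical.

Let empirical_setT : empirical [set: borel X] = 1%E.
Proof.
rewrite /empirical/= /mscale/= /msum.
rewrite (eq_bigr (fun=> 1%:E)) => [|i _]; last exact: diracT.
by rewrite sumEFin sumr_const card_ord -EFinM mulVf// pnatr_eq0.
Qed.

HB.instance Definition _ :=
  Measure_isProbability.Build _ _ _ empirical empirical_setT.

End empirical.

(* The weak* topology: the coarsest one for which every map
   mu |-> \int phi dmu, with phi : X -> R[i] continuous, is continuous. *)
Definition weak_star {R : realType} (X : pmetricType R) : topologicalType :=
  initial_topology
    ((fun mu phi => cintegral mu phi) :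
       probability (borel X) R -> {ptws continuousType X R[i] -> R[i]}).

(* Main.v *)
(* For (1) => (2), Birkhoff's theorem is only needed in the ergodic case.  With
   M_0 = 0 and M_(n+1) = max 0 (f + M_n o T), the maximum of the first Birkhoff
   sums, the set where M_n is unbounded is invariant, and it cannot have full
   measure when f has negative integral; so almost every sequence of Birkhoff
   sums of such an f is bounded above, and applying this to
   +-(f - integral of f) - e gives the convergence of the averages of f.  One
   null set serves all continuous functions because C(X) is spanned, up to
   uniform limits, by countably many functions.  (2) and (3) are the same since
   the integral against the n-th empirical measure is the n-th average, and (4)
   is (5) by continuity from above.  For (5) => (1), comparing the limits of the
   averages of f and f o T gives invariance, and integrating the averages over
   an invariant set B shows that B is independent of itself. *)
From HB Require Import structures.
Require Import Defs.
From mathcomp Require Import all_boot all_order all_algebra.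
From mathcomp Require Import all_classical all_reals all_analysis.
From mathcomp Require Import complex.
From mathcomp Require Import lra measurable_realfun.
Import Order.TTheory GRing.Theory Num.Theory.
Import numFieldNormedType.Exports.
Local Open Scope classical_set_scope.
Local Open Scope complex_scope.
Local Open Scope ring_scope.

(** * The ergodic theorem for bounded functions *)

Section birkhoff.
Context {d : measure_display} {Y : measurableType d} {R : realType}.
Context (mu : probability Y R) (T : Y -> Y).
Context (mT : measurable_fun setT T).
Context (invT : forall B, measurable B -> mu (T @^-1` B) = mu B).
Context (ergT : forall B, measurable B -> T @^-1` B = B -> mu B = 0%E \/ mu B = 1%E).

Lemma bounded_integrable (A : set Y) (h : Y -> R) (C : R) : measurable A ->
  measurable_fun setT h -> (forall x, `|h x| <= C) ->
  mu.-integrable A (EFin \o h).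
Proof.
move=> mA mh hC; apply: measurable_bounded_integrable => //.
- by rewrite (le_lt_trans (probability_le1 _ mA))// ltry.
- exact: measurable_funTS.
- by exists C; split => [|M CM x _]; [exact: num_real|exact: le_trans (hC x) (ltW CM)].
Qed.

(** The pushforward of [mu] under [T] agrees with [mu] on measurable sets, so this is the change of
    variables formula. The domain [D] is general so that it can later be an invariant set. *)
Lemma Rintegral_comp_invariant (D : set Y) (h : Y -> R) (C : R) : measurable D ->
  measurable_fun setT h -> (forall x, `|h x| <= C) ->
  \int[mu]_(x in T @^-1` D) h (T x) = \int[mu]_(x in D) h x.
Proof.
move=> mD mh hC; rewrite /Rintegral.
have mTD : measurable (T @^-1` D) by rewrite -[X in measurable X]setTI; exact: mT.
have -> : (\int[mu]_(x in D) (h x)%:E = \int[pushforward mu T]_(x in D) (h x)%:E)%E.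
  apply: eq_measure_integral => A mA _; exact/esym/invT.
rewrite integral_pushforward//; first exact/measurable_EFinP.
apply: (bounded_integrable _ (h \o T) C) => // [|x]; last exact: hC.
exact: measurableT_comp.
Qed.

Fixpoint max_birkhoff_sum (f : Y -> R) n x : R :=
  if n is m.+1 then Num.max 0 (f x + max_birkhoff_sum f m (T x)) else 0.

Local Notation M := max_birkhoff_sum.

Lemma max_birkhoff_sum_ge0 (f : Y -> R) n x : 0 <= M f n x.
Proof. by case: n => //= n; rewrite le_max lexx. Qed.

Lemma le_max_birkhoff_sum (f : Y -> R) n x : M f n x <= M f n.+1 x.
Proof.
elim: n x => [x|n IHn x]; first exact: max_birkhoff_sum_ge0.
rewrite -[M f n.+1 x]/(Num.max 0 (f x + M f n (T x))).
by rewrite -[M f n.+2 x]/(Num.max 0 (f x + M f n.+1 (T x))) le_max2// lerD2l.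
Qed.

Lemma measurable_max_birkhoff_sum (f : Y -> R) n : measurable_fun setT f ->
  measurable_fun setT (M f n).
Proof.
move=> mf; elim: n => [|n IHn] /=; first exact: measurable_cst.
apply: measurable_maxr; first exact: measurable_cst.
by apply: measurable_funD => //; exact: measurableT_comp.
Qed.

Lemma max_birkhoff_sum_le (f : Y -> R) (C : R) n x : (forall x, `|f x| <= C) ->
  `|M f n x| <= n%:R * C.
Proof.
move=> fC; have C0 : 0 <= C by rewrite (le_trans _ (fC x)).
rewrite ger0_norm ?max_birkhoff_sum_ge0//.
elim: n x => [x|n IHn x] /=; first by rewrite mul0r.
rewrite ge_max mulr_ge0//= -natr1 mulrDl mul1r addrC lerD//.
exact: le_trans (ler_norm _) (fC x).
Qed.

Lemma birkhoff_sum_le_max (f : Y -> R) n x : \sum_(i < n) f (iter i T x) <= M f n x.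
Proof.
elim: n x => [x|n IHn x]; first by rewrite big_ord0.
rewrite big_ord_recl /= le_max; apply/orP; right; rewrite lerD2l.
rewrite (le_trans _ (IHn (T x)))// ler_sum// => i _.
by rewrite -iterSr.
Qed.

(* M_{n+1} - M_n o T = max (- M_n o T) f decreases to f where M_n is unbounded,
   and its integral is the integral of M_{n+1} - M_n >= 0. *)
Lemma maximal_ergodic (f : Y -> R) (C : R) : measurable_fun setT f ->
  (forall x, `|f x| <= C) ->
  {ae mu, forall x, forall K, exists n, K < M f n x} -> 0 <= \int[mu]_x f x.
Proof.
move=> mf fC unbdd.
pose g n x := M f n.+1 x - M f n (T x).
have mM n := measurable_max_birkhoff_sum f n mf.
have iM n : mu.-integrable setT (EFin \o M f n).
  by apply: (bounded_integrable _ (M f n) (n%:R * C)) => // x; exact: max_birkhoff_sum_le.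
have mMT n : measurable_fun setT (M f n \o T) by exact: measurableT_comp.
have iMT n : mu.-integrable setT (EFin \o (M f n \o T)).
  apply: (bounded_integrable _ _ (n%:R * C)) => // x.
  exact: (max_birkhoff_sum_le f C n (T x)).
have g_ge0 n : 0 <= \int[mu]_x g n x.
  rewrite RintegralB//; last exact: iMT.
  have -> : \int[mu]_x M f n (T x) = \int[mu]_x M f n x.
    rewrite -(Rintegral_comp_invariant setT (M f n) (n%:R * C))//.
    by move=> x; exact: max_birkhoff_sum_le.
  by rewrite subr_ge0 le_Rintegral// => x _; exact: le_max_birkhoff_sum.
have gE n x : g n x = Num.max (- M f n (T x)) (f x).
  by rewrite /g /= addr_maxl sub0r addrK.
have mg n : measurable_fun setT (EFin \o g n).
  by apply/measurable_EFinP; apply: measurable_funB; [exact: mM|exact: mMT].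
have mEf : measurable_fun setT (EFin \o f) by exact/measurable_EFinP.
have ifC : mu.-integrable setT (cst C%:E).
  by apply: (bounded_integrable setT (cst C) `|C|) => //; exact: measurable_cst.
(* [- M f n (T x) <= 0 <= C], so its maximum with [f x] stays between [-C] and [C]. *)
have gC x n : `|g n x| <= C.
  have := fC x; rewrite gE !ler_norml => /andP[Cf fC'].
  rewrite le_max Cf orbT ge_max fC' andbT lerNl (le_trans _ (max_birkhoff_sum_ge0 f n _))//.
  by rewrite oppr_le0 (le_trans _ (fC x)).
(* Once [M f n x] exceeds [2 * C >= 0], so does [M f m.+1 x] for [m >= n]; its maximum is then
   attained by [f x + M f m (T x) > 0], which makes [g m x] equal to [f x]. *)
have gf : {ae mu, forall x, [set: Y] x -> (EFin \o g n) x @[n --> \oo] --> (f x)%:E}.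
  apply: filterS unbdd => x Kx _.
  have [n Kn] := Kx (2 * C).
  apply: (cvg_near_cst (f x)%:E).
  exists n => // m /= nm; rewrite gE; congr EFin; apply/max_idPr.
  have nMm : M f n x <= M f m.+1 x.
    have: (n <= m.+1)%N by exact: leqW.
    elim: m.+1 => [|k IHk]; first by rewrite leqn0 => /eqP ->.
    rewrite leq_eqVlt => /predU1P[->//|]; rewrite ltnS => /IHk/le_trans; apply.
    exact: le_max_birkhoff_sum.
  have := lt_le_trans Kn nMm => /=.
  have C0 : 0 <= C by rewrite (le_trans _ (fC x)).
  rewrite lt_max ltNge mulr_ge0//= => CfM.
  have := fC x; rewrite ler_norml => /andP[Cf fC'].
  lra.
have [_ _] := @dominated_convergence _ _ _ mu setT measurableT (fun n => EFin \o g n)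
  (EFin \o f) (cst C%:E) mg mEf gf ifC
  (aeW _ (fun x n _ => gC x n : (`|(g n x)%:E| <= C%:E)%E)).
have if_ : mu.-integrable setT (EFin \o f) by exact: (bounded_integrable _ f C).
rewrite -[X in _ --> X]fineK; last exact: integrable_fin_num.
move=> /fine_cvg gfi; apply: (cvgr_to_ge gfi).
by apply: nearW => n; exact: g_ge0.
Qed.


(* The set where M_n is unbounded is T-invariant; if it had measure 1, the
   maximal inequality would give f a nonnegative integral. *)
Lemma birkhoff_sum_bounded_above (f : Y -> R) (C : R) : measurable_fun setT f ->
  (forall x, `|f x| <= C) -> \int[mu]_x f x < 0 ->
  {ae mu, forall x, exists K, forall n, \sum_(i < n) f (iter i T x) <= K}.
Proof.
move=> mf fC f0; pose B := [set x | forall K, exists n, K < M f n x].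
have mB : measurable B.
  rewrite (_ : B = \bigcap_k \bigcup_n ((M f n) @^-1` `]k%:R, +oo[)).
    apply: bigcap_measurable => // k _; apply: bigcup_measurable => n _.
    by rewrite -[X in measurable X]setTI; exact: measurable_max_birkhoff_sum.
  apply/seteqP; split => x /= Bx.
    by move=> k _; have [n kn] := Bx k%:R; exists n => //=; rewrite in_itv/= kn.
  move=> K; have [n _] := Bx (Num.truncn `|K|).+1 I.
  rewrite /= in_itv/= andbT => Kn; exists n; rewrite (le_lt_trans _ Kn)//.
  by rewrite (le_trans (ler_norm _))// ltW// truncnS_gt.
(* Passing from [T x] to [x] changes the sums by [f x], of size at most [C], so thresholds move by
   [C]; the absolute value of [K] rules out the 0 branch of the maximum. *)
have TB : T @^-1` B = B.
  apply/seteqP; split => x /= Bx K.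
    have [n Kn] := Bx (K + C); exists n.+1; rewrite /= lt_max; apply/orP; right.
    by have := fC x; rewrite ler_norml => /andP[? ?]; lra.
  have [[|n]/= Kn] := Bx (`|K| + C).
    have := le_trans (normr_ge0 _) (fC x); have := normr_ge0 K; lra.
  exists n; move: Kn; rewrite lt_max; have := fC x; rewrite ler_norml => /andP[? ?].
  have := ler_norm K; have := normr_ge0 K => ? ? /orP[?|?]; lra.
have [B0|B1] := ergT B mB TB.
  exists B; split => // x /= nK; apply: contrapT => nBx; apply: nK.
  have /existsNP[K nKx] := nBx; exists K => n.
  rewrite (le_trans (birkhoff_sum_le_max f n x))// leNgt; apply/negP => KM.
  by apply: nKx; exists n.
suff : 0 <= \int[mu]_x f x by rewrite leNgt f0.
apply: (maximal_ergodic f C) => //; exists (~` B); split => //.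
- exact: measurableC.
- by rewrite probability_setC// B1 subee.
Qed.

(** With [I] the integral of [f], the sums of [f - I - e / 2] are almost everywhere bounded above by
    some [K], so the averages of [f] are at most [I + e / 2 + K / n]. The tolerances [m.+1%:R^-1]
    keep the null sets countable in number. *)
Lemma birkhoff_avg_limsup_le (f : Y -> R) (C : R) : measurable_fun setT f ->
  (forall x, `|f x| <= C) ->
  {ae mu, forall x, forall m, \forall n \near \oo,
    n%:R^-1 * \sum_(i < n) f (iter i T x) <= \int[mu]_x f x + m.+1%:R^-1}.
Proof.
move=> mf fC; apply: ae_foralln => m; set I := \int[mu]_x f x.
pose e : R := m.+1%:R^-1; have e0 : 0 < e by rewrite /e invr_gt0.
pose c : R := I + e / 2.
have mg : measurable_fun setT (fun x => f x - c) by exact: measurable_funB.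
have gC x : `|f x - c| <= C + `|c| by rewrite (le_trans (ler_normB _ _))// lerD2r.
have ig : \int[mu]_x (f x - c) < 0.
  rewrite RintegralB//; first last.
  - by apply: (bounded_integrable _ (cst c) `|c|).
  - exact: (bounded_integrable _ f C).
  rewrite Rintegral_cst// (congr1 fine (probability_setT mu)) mulr1 -/I /c; lra.
have := birkhoff_sum_bounded_above _ _ mg gC ig; apply: filterS => x [K SK].
(* Beyond this index, [K / n <= e / 2]. *)
exists (Num.truncn (2 * `|K| / e)).+1 => // n /= nK.
have n0 : 0 < n%:R :> R by rewrite ltr0n (leq_ltn_trans _ nK).
rewrite mulrC ler_pdivrMr//.
have := SK n; rewrite sumrB sumr_const card_ord -[c *+ n]mulr_natr => SKn.
have : 2 * `|K| / e <= n%:R.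
  by rewrite (le_trans (ltW (truncnS_gt _)))// ler_nat.
rewrite ler_pdivrMr// -/e => Kne; have := ler_norm K.
rewrite /c in SKn; nra.
Qed.

(** The upper bound for [f] controls the limsup, the one for [- f] the liminf. *)
Lemma birkhoff_avg_ae_cvg (f : Y -> R) (C : R) : measurable_fun setT f ->
  (forall x, `|f x| <= C) ->
  {ae mu, forall x, n%:R^-1 * \sum_(i < n) f (iter i T x) @[n --> \oo]
    --> \int[mu]_x f x}.
Proof.
move=> mf fC.
have mNf : measurable_fun setT (\- f) by exact: measurableT_comp.
have NfC x : `|(\- f) x| <= C by rewrite normrN.
have := birkhoff_avg_limsup_le _ _ mNf NfC.
apply: filterS2 (birkhoff_avg_limsup_le _ _ mf fC) => x fx Nfx.
apply/cvgrPdist_le => /= e e0.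
have [m me] : exists m, m.+1%:R^-1 <= e.
  exists (Num.truncn e^-1); rewrite -[leRHS]invrK lef_pV2 ?posrE ?invr_gt0//.
  by rewrite ltW// truncnS_gt.
have IN : \int[mu]_x (\- f) x = - \int[mu]_x f x.
  under eq_Rintegral do rewrite /= -mulN1r.
  rewrite RintegralZl ?mulN1r//; exact: (bounded_integrable _ f C).
near=> n.
have fn : n%:R^-1 * \sum_(i < n) f (iter i T x) <= \int[mu]_x f x + m.+1%:R^-1.
  by near: n; exact: fx.
have : n%:R^-1 * \sum_(i < n) (\- f) (iter i T x) <= \int[mu]_x (\- f) x + m.+1%:R^-1.
  by near: n; exact: Nfx.
have -> : \sum_(i < n) (\- f) (iter i T x) = - \sum_(i < n) f (iter i T x).
  by rewrite -sumrN.
rewrite IN mulrN ler_norml => Nfn; move: fn me Nfn.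
set a := n%:R^-1 * _; set b := Rintegral _ _ _; set c := _%:R^-1.
move: a b c => a b c ? ? ?.
by apply/andP; split; lra.
Unshelve. all: by end_near. Qed.

End birkhoff.

(** * Continuous functions on a compact metric space *)

Section metric_functions.
Context {R : realType} {X : pmetricType R}.

Lemma continuous_measurable_borel (f : X -> R) : continuous f ->
  measurable_fun [set: borel X] (f : borel X -> R).
Proof.
move=> cf; apply: (measurability _ (RGenOInfty.measurableE R)).
move=> _ [_ [r ->] <-]; rewrite setTI; apply: sub_sigma_algebra.
by apply: open_comp => //; exact: interval_open.
Qed.

Lemma continuous_borel_map (T : X -> X) : continuous T ->
  measurable_fun [set: borel X] (T : borel X -> borel X).
Proof.
move=> cT; apply: (@measurability _ _ (borel X) (borel X) setT T (@open X)) => //.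
by move=> _ [U oU <-]; rewrite setTI; apply: sub_sigma_algebra; exact: open_comp.
Qed.

(** The one-sided bound suffices, since exchanging [x] and [y] yields the other side. *)
Lemma lipschitz1_continuous (h : X -> R) :
  (forall x y, h x <= h y + mdist x y) -> continuous h.
Proof.
move=> h1 x; apply/cvgrPdist_lt => /= e e0.
have : \forall y \near x, ball x e y by exact: nbhsx_ballx.
apply: filterS => y; rewrite ballEmdist/= => xye.
rewrite ltr_norml; have := h1 x y; have := h1 y x; rewrite metric_sym => *.
by apply/andP; split; lra.
Qed.

Definition bump (e : R) (z x : X) : R := Num.max 0 (e - mdist z x).

Lemma bump_ge0 e z x : 0 <= bump e z x.
Proof. by rewrite le_max lexx. Qed.

Lemma bump_gt0 e z x : (0 < bump e z x) = (mdist z x < e).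
Proof. by rewrite lt_max ltxx subr_gt0. Qed.

Lemma bump_continuous e z : continuous (bump e z).
Proof.
apply: lipschitz1_continuous => x y; rewrite /bump.
rewrite ge_max addr_ge0 ?mdist_ge0 ?le_max ?lexx//=.
rewrite addr_maxl le_max; apply/orP; right.
have := metric_triangle z x y; lra.
Qed.

Hypothesis cptX : compact [set: X].

Lemma continuous_compact_bounded (f : X -> R) : continuous f ->
  exists C : R, forall x, `|f x| <= C.
Proof.
move=> cf.
have /compact_bounded[M [_ MC]] : compact (f @` [set: X]).
  by apply: continuous_compact => //; exact: continuous_subspaceT.
by exists (M + 1) => x; apply: MC; [rewrite ltrDl|exists x].
Qed.

Lemma compact_unif_continuous (f : X -> R) (e : R) : continuous f -> 0 < e ->
  exists m : nat, forall x y, mdist x y < m.+1%:R^-1 -> `|f x - f y| <= e.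
Proof.
(* Compactness in near-covering form: it suffices to find around each [x] a neighbourhood and a
   threshold on [m] that work together. *)
move=> cf e0; have /compact_near_coveringP/(_ nat \oo
  (fun m x => forall y, mdist x y < m.+1%:R^-1 -> `|f x - f y| <= e)) := cptX.
case=> [x _|m _ /(_ m (leqnn m)) mP]; last by exists m => x y; exact: mP.
have /cvgrPdist_lt/(_ (e / 2)) := cf x; rewrite divr_gt0// => /(_ isT).
rewrite -nbhs_ballE => -[r /= r0 xr].
(* Then [x'] and [y] both lie within [r] of [x], where [f] differs from [f x] by less than
   [e / 2]. *)
exists (ball x (r / 2), [set m | m.+1%:R^-1 < r / 2]).
  split; first by apply: nbhsx_ballx; rewrite divr_gt0.
  have r20 : 0 < r / 2 by rewrite divr_gt0.
  exists (Num.truncn (r / 2)^-1) => //= m /= rm.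
  rewrite invf_plt ?posrE// (lt_le_trans (truncnS_gt _))//.
  by rewrite ler_nat ltnS.
move=> [x' m] /= [xx' mr] y x'y.
have fx' : `|f x - f x'| < e / 2.
  by apply: xr; move: xx'; rewrite !ballEmdist/= => ?; lra.
have fy : `|f x - f y| < e / 2.
  apply: xr; move: xx'; rewrite !ballEmdist/= => xx'.
  by rewrite (le_lt_trans (metric_triangle x x' y))// [ltRHS]splitr ltrD// (lt_trans x'y).
have := ler_distD (f x) (f x') (f y); rewrite (distrC (f x') (f x)); lra.
Qed.

(** The centres come as a numbered list because they index the functions [p m i] below. *)
Lemma compact_net (e : R) : 0 < e ->
  exists s : seq X, forall x, exists2 i, (i < size s)%N & mdist (nth point s i) x < e.
Proof.
move=> e0; move: (cptX); rewrite compact_cover.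
case/(_ X setT (fun z => [set x | mdist z x < e])).
- move=> z _; apply: (@open_comp _ _ (fun x => mdist z x) [set r | r < e]) => //.
    move=> x _; apply: lipschitz1_continuous => x' y'.
    by rewrite (metric_sym x') metric_triangle.
- by move=> x _; exists x => //=; rewrite mdistxx.
move=> D _ XD; exists (finmap.enum_fset D) => x.
have [z /= zD zx] := XD x I; exists (index z (finmap.enum_fset D)).
  by rewrite index_mem.
by rewrite nth_index.
Qed.

(* The p m i are partitions of unity subordinate to finite covers by balls of
   radius 1/(m+1). *)
Lemma continuous_separable : exists p : nat -> nat -> X -> R,
  (forall m i, continuous (p m i)) /\
  (forall f : X -> R, continuous f -> forall e : R, 0 < e ->
    exists m N (c : nat -> R),
      forall x, `|f x - \sum_(i < N) c i * p m i x| <= e).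
Proof.
have m0 m : 0 < m.+1%:R^-1 :> R by rewrite invr_gt0.
have /choice[s sP] := fun m => compact_net _ (m0 m).
pose b m i := bump m.+1%:R^-1 (nth point (s m) i).
pose S m x := \sum_(i < size (s m)) b m i x.
have S_gt0 m x : 0 < S m x.
  have [i im ix] := sP m x; rewrite /S (bigD1 (Ordinal im))//=.
  by rewrite ltr_pwDl ?bump_gt0// sumr_ge0// => j _; exact: bump_ge0.
have cS m : continuous (S m).
  by apply: continuous_big => [|i _]; [exact: add_continuous|exact: bump_continuous].
(* Beyond the length of [s m] the centre is the default [point], so the function is defined and
   continuous for every [i]. *)
exists (fun m i x => b m i x / S m x); split=> [m i x|f cf e e0].
  apply: cvgM; first exact: bump_continuous.
  by apply: cvgV; [rewrite gt_eqF|exact: cS].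
have [m mP] := compact_unif_continuous _ _ cf e0.
(* [f] is sampled at the centres; a centre whose weight at [x] is nonzero is within [m.+1%:R^-1] of
   [x], so its sample is within [e] of [f x]. *)
exists m, (size (s m)), (fun i => f (nth point (s m) i)) => x.
have -> : f x = \sum_(i < size (s m)) f x * (b m i x / S m x).
  by rewrite -mulr_sumr -mulr_suml -/(S m x) divff ?mulr1// gt_eqF.
rewrite -sumrB (le_trans (ler_norm_sum _ _ _))//.
have -> : e = \sum_(i < size (s m)) e * (b m i x / S m x).
  by rewrite -mulr_sumr -mulr_suml -/(S m x) divff ?mulr1// gt_eqF.
apply: ler_sum => i _; rewrite -mulrBl normrM.
have bS0 : 0 <= b m i x / S m x by rewrite divr_ge0 ?bump_ge0// ltW.
rewrite (ger0_norm bS0).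
have := bump_ge0 m.+1%:R^-1 (nth point (s m) i) x; rewrite le_eqVlt => /predU1P[b0|].
  by rewrite /b -b0 mul0r !mulr0.
by rewrite bump_gt0 metric_sym => /mP fe; rewrite ler_wpM2r.
Qed.

(* g k = min 1 (k h), where h x is the largest radius r <= 1 of a ball around x
   contained in U. *)
Lemma open_indic_approx (U : set X) : open U -> exists g : nat -> X -> R,
  [/\ forall k, continuous (g k), forall k x, 0 <= g k x <= 1 &
    forall x, g k x @[k --> \oo] --> (\1_U x : R)].
Proof.
(* [S x] contains 0 even for [x] outside [U], since the ball of radius 0 is empty; the cap 1 keeps
   the supremum finite even when [U] is the whole space. *)
move=> oU; pose S (x : X) := [set r : R | 0 <= r <= 1 /\ ball x r `<=` U].
have ball0 (x : X) : ball x 0 = set0.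
  by rewrite ballEmdist -subset0 => y/=; rewrite ltNge mdist_ge0.
have S0 x : S x 0 by split; [rewrite lexx ler01|rewrite ball0].
have supS x : has_sup (S x).
  by split; [exists 0|exists 1 => r /= [/andP[]]].
pose h x := sup (S x).
have h01 x : 0 <= h x <= 1.
  rewrite (sup_upper_bound (supS x))//=; apply: sup_le_ub; first by exists 0.
  by move=> r /= [/andP[]].
(* If [r] is admissible at [x], then [r - mdist x y] is admissible at [y] when positive; otherwise
   [0 <= h y] suffices. *)
have ch : continuous h.
  apply: lipschitz1_continuous => x y; apply: sup_le_ub; first by exists 0.
  move=> r /= [/andP[r0 r1] xrU]; rewrite -lerBlDr.
  have [rxy|xyr] := leP r (mdist x y).
    by rewrite (le_trans _ (andP (h01 y)).1)// subr_le0.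
  apply: (sup_upper_bound (supS y)); split.
    by have ? := mdist_ge0 x y; apply/andP; split; lra.
  move=> z; rewrite ballEmdist/= => yz; apply: xrU; rewrite ballEmdist/=.
  by have := metric_triangle x y z; lra.
have h_gt0 x : U x -> 0 < h x.
  move=> Ux; have := open_nbhs_nbhs (conj oU Ux); rewrite -nbhs_ballE => -[r /= r0 xrU].
  have m0 : 0 < Num.min r 1 by rewrite lt_min r0 ltr01.
  rewrite (lt_le_trans m0)//; apply: (sup_upper_bound (supS x)); split.
    by rewrite ltW//= ge_min lexx orbT.
  by apply: subset_trans xrU; apply: le_ball; rewrite ge_min lexx.
have h0 x : ~ U x -> h x = 0.
  move=> Ux; apply/eqP; rewrite eq_le (andP (h01 x)).1 andbT.
  apply: sup_le_ub; first by exists 0.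
  move=> r [_ xrU]; rewrite leNgt; apply/negP => r0; apply: Ux; apply: xrU.
  exact: ballxx.
exists (fun k x => Num.min 1 (k%:R * h x)); split.
- move=> k x; apply: (@continuous_min _ _ (fun=> 1) (fun y => k%:R * h y)).
    exact: cvg_cst.
  by apply: cvgM; [exact: cvg_cst|exact: ch].
- move=> k x; rewrite le_min ler01 mulr_ge0//= ?(andP (h01 x)).1//.
  by rewrite ge_min lexx.
move=> x; rewrite indicE; have [xU|xU] := boolP (x \in U); last first.
  rewrite (h0 x (fun Ux => negP xU (mem_set Ux))).
  by apply: cvg_near_cst; apply: nearW => k; rewrite mulr0; apply/min_idPr.
have hx := h_gt0 x (set_mem xU).
apply: cvg_near_cst; exists (Num.truncn (h x)^-1).+1 => // k /= hk.
apply/min_idPl; rewrite -ler_pdivrMr// div1r (le_trans (ltW (truncnS_gt _)))//.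
by rewrite ler_nat.
Qed.

End metric_functions.

(** * Real and imaginary parts *)

Section complex_convergence.
Context {R : realType}.
Implicit Types (z l : R[i]).

Lemma normc_ge_Im z : `|complex.Im z|%:C <= `|z|.
Proof.
case: z => a b; rewrite normc_def lecR /= -sqrtr_sqr ler_wsqrtr//.
by rewrite lerDr sqr_ge0.
Qed.

Lemma normc_le_ReIm z : `|z| <= (`|complex.Re z| + `|complex.Im z|)%:C.
Proof.
case: z => a b /=; rewrite normc_def lecR /= -[leRHS]ger0_norm ?addr_ge0//.
rewrite -sqrtr_sqr ler_wsqrtr// sqrrD !real_normK ?num_real//.
by rewrite lerD2r lerDl mulrn_wge0// mulr_ge0.
Qed.

(** Both parts are bounded by the modulus, and the modulus by the sum of their absolute values. *)
Lemma cvg_complexP {I : Type} (F : set_system I) (FF : Filter F) (z : I -> R[i]) l :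
  z @ F --> l <-> (complex.Re (z i) @[i --> F] --> complex.Re l) /\
                  (complex.Im (z i) @[i --> F] --> complex.Im l).
Proof.
split=> [zl|[Rzl Izl]].
  have zle (e : R) : 0 < e -> \forall i \near F, `|l - z i| < e%:C.
    by move=> e0; move/cvgrPdist_lt : zl; apply; rewrite -ltcR in e0.
  split; apply/cvgrPdist_lt => /= e /zle; apply: filterS => i lze; rewrite -ltcR.
    rewrite (le_lt_trans _ lze)// -raddfB/=; exact: normc_ge_Re.
  rewrite (le_lt_trans _ lze)// -raddfB/=; exact: normc_ge_Im.
apply/cvgrPdist_le => /= e e0.
(* A positive element of [R[i]] is real, so the tolerance is a real [r], half of it for each
   part. *)
have /complex_realP[r er] := gtr0_real e0.
rewrite er (ltcR 0) in e0; rewrite {}er.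
move/cvgrPdist_le : Rzl => /(_ (r / 2)); rewrite divr_gt0// => /(_ isT) Rzl.
move/cvgrPdist_le : Izl => /(_ (r / 2)); rewrite divr_gt0// => /(_ isT) Izl.
apply: filterS2 Rzl Izl => i Rzl Izl.
rewrite (le_trans (normc_le_ReIm _))// lecR [leRHS]splitr.
case: l (z i) Rzl Izl => [a b] [c d] /= *; exact: lerD.
Qed.

(** Bridges the off-by-one between [empirical], which averages [n.+1] masses, and [birkhoff_avg]. *)
Lemma cvg_complex_shiftS (z : nat -> R[i]) l :
  z n.+1 @[n --> \oo] --> l <-> z n @[n --> \oo] --> l.
Proof.
split=> /cvg_complexP[zR zI]; apply/cvg_complexP.
  by rewrite -2!(cvg_shiftS (fun n => _ (z n))).
by rewrite 2!(cvg_shiftS (fun n => _ (z n))).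
Qed.

Lemma continuous_complexP {X : topologicalType} (phi : X -> R[i]) :
  continuous phi <->
  continuous (fun x => complex.Re (phi x)) /\ continuous (fun x => complex.Im (phi x)).
Proof.
split=> [cphi|[cR cI] x]; last by apply/cvg_complexP; split; [exact: cR|exact: cI].
by split=> x; have /cvg_complexP[] := cphi x.
Qed.

End complex_convergence.

(** * Birkhoff averages and their real and imaginary parts *)

Section birkhoff_avg.
Context {R : realType} {X : pmetricType R}.

Definition real_birkhoff_avg (T : X -> X) (f : X -> R) n x : R :=
  n%:R^-1 * \sum_(i < n) f (iter i T x).

Lemma birkhoff_avgE (T : X -> X) (phi : X -> R[i]) n x :
  birkhoff_avg T phi n x =
  real_birkhoff_avg T (fun x => complex.Re (phi x)) n x +i*
  real_birkhoff_avg T (fun x => complex.Im (phi x)) n x.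
Proof.
have -> : birkhoff_avg T phi n x =
    (n%:R^-1 : R)%:C * \sum_(i < n) phi (iter i T x).
  by rewrite /birkhoff_avg fmorphV/= rmorph_nat.
rewrite /real_birkhoff_avg.
have -> : \sum_(i < n) phi (iter i T x) =
    (\sum_(i < n) complex.Re (phi (iter i T x))) +i*
    (\sum_(i < n) complex.Im (phi (iter i T x))).
  elim: n => [|n IHn]; first by rewrite !big_ord0.
  by rewrite !big_ord_recr/= IHn; case: (phi _).
by simpc.
Qed.

Lemma cvg_birkhoff_avgP (T : X -> X) (mu : probability (borel X) R) (phi : X -> R[i]) x :
  birkhoff_avg T phi n x @[n --> \oo] --> cintegral mu phi <->
  (real_birkhoff_avg T (fun x => complex.Re (phi x)) n x @[n --> \oo] -->
     \int[mu]_x complex.Re (phi x)) /\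
  (real_birkhoff_avg T (fun x => complex.Im (phi x)) n x @[n --> \oo] -->
     \int[mu]_x complex.Im (phi x)).
Proof.
under eq_fun do rewrite birkhoff_avgE.
exact: cvg_complexP.
Qed.

Lemma continuous_iter (T : X -> X) i : continuous T -> continuous (iter i T).
Proof.
move=> cT; elim: i => [|k IHk] x; first exact: cvg_id.
by apply: continuous_comp; [exact: IHk|exact: cT].
Qed.

Lemma real_birkhoff_avg_continuous (T : X -> X) (f : X -> R) n :
  continuous T -> continuous f -> continuous (real_birkhoff_avg T f n).
Proof.
move=> cT cf x; apply: cvgM; first exact: cvg_cst.
move: x; apply: continuous_big => [|i _]; first exact: add_continuous.
by move=> x; apply: continuous_comp; [exact: continuous_iter|exact: cf].
Qed.

End birkhoff_avg.

(** * Integrals of continuous functions and weak* convergence *)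

Section continuous_integrals.
Context {R : realType} {X : pmetricType R}.
Hypothesis cptX : compact [set: X].

Lemma continuous_integrable (mu : probability (borel X) R) (A : set (borel X))
    (f : X -> R) :
  continuous f -> measurable A -> mu.-integrable A (EFin \o f).
Proof.
move=> cf mA; have [C fC] := continuous_compact_bounded cptX f cf.
apply: (bounded_integrable mu A f C) => //; exact: continuous_measurable_borel.
Qed.

(** Dominated convergence with dominating function 1. It transfers identities between integrals of
    continuous functions to measures of open sets; [A] allows restriction to an invariant set. *)
Lemma cvg_Rintegral_indic (mu : probability (borel X) R) (A V : set (borel X))
    (g : nat -> borel X -> R) :
  measurable A -> measurable V -> (forall k, measurable_fun setT (g k)) ->
  (forall k x, 0 <= g k x <= 1) -> (forall x, g k x @[k --> \oo] --> (\1_V x : R)) ->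
  \int[mu]_(x in A) g k x @[k --> \oo] --> fine (mu (V `&` A)).
Proof.
move=> mA mV mg g01 gV.
have mgE k : measurable_fun A (EFin \o g k) by apply/measurable_EFinP/measurable_funTS.
have m1 : measurable_fun A (EFin \o (\1_V : borel X -> R)).
  by apply/measurable_EFinP; exact: measurable_indic.
have i1 : mu.-integrable A (cst 1%:E).
  by apply: (bounded_integrable mu A (cst 1) `|1|) => //; exact: measurable_cst.
have g1 x k : A x -> (`|(g k x)%:E| <= 1%:E)%E.
  by move=> _; have /andP[g0 g1] := g01 k x; rewrite lee_fin ger0_norm.
have gf : {ae mu, forall x, A x -> (EFin \o g k) x @[k --> \oo] --> (EFin \o \1_V) x}.
  by apply: aeW => x _; apply: cvg_EFin; [exact: nearW|exact: gV].
have [_ _] := dominated_convergence mA mgE m1 gf i1 (aeW _ g1).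
rewrite /= integral_indic// => h; apply: fine_cvg.
rewrite fineK//; apply: fin_num_measure; exact: measurableI.
Qed.

Lemma empirical_Rintegral (T : X -> X) (f : X -> R) y n : continuous f ->
  \int[empirical T y n]_x f x = real_birkhoff_avg T f n.+1 y.
Proof.
move=> cf; have [C fC] := continuous_compact_bounded cptX f cf.
have mf : measurable_fun [set: borel X] (f : borel X -> R).
  exact: continuous_measurable_borel.
(* Integrals against a scaled sum of Dirac masses are computed for nonnegative functions; adding [C]
   makes [f] nonnegative, and [C] cancels at the end because the total mass is 1. *)
have mfC : measurable_fun [set: borel X] (fun x => f x + C : R).
  by apply: measurable_funD => //; exact: measurable_cst.
have fC0 x : 0 <= f x + C.
  by have := fC x; rewrite ler_norml => /andP[? _]; rewrite -lerBlDr sub0r.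
have sumfC : \int[empirical T y n]_x (f x + C) =
    n.+1%:R^-1 * \sum_(i < n.+1) (f (iter i T y) + C).
  rewrite /Rintegral ge0_integral_mscale//=; last 2 first.
  - exact/measurable_EFinP.
  - by move=> x _; rewrite lee_fin.
  rewrite ge0_integral_measure_sum//=; last 2 first.
  - by move=> x _; rewrite lee_fin.
  - exact/measurable_EFinP.
  rewrite (eq_bigr (fun i : 'I_n.+1 => (f (iter i T y) + C)%:E)); last first.
    by move=> i _; rewrite integral_dirac// ?diracT ?mul1e//; exact/measurable_EFinP.
  by rewrite sumEFin.
have : \int[empirical T y n]_x (f x + C) = \int[empirical T y n]_x f x + C.
  rewrite RintegralD//; first last.
  - by apply: (bounded_integrable _ _ (cst C) `|C|) => //; exact: measurable_cst.
  - exact: continuous_integrable.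
  by rewrite Rintegral_cst// (congr1 fine (probability_setT (empirical T y n))) mulr1.
rewrite sumfC big_split/= sumr_const card_ord mulrDr -[C *+ _]mulr_natl.
by rewrite mulKf ?pnatr_eq0// => /addIr.
Qed.

Lemma empirical_cintegral (T : X -> X) (phi : X -> R[i]) y n : continuous phi ->
  cintegral (empirical T y n) phi = birkhoff_avg T phi n.+1 y.
Proof.
move=> /continuous_complexP[cR cI].
by rewrite birkhoff_avgE /cintegral !empirical_Rintegral.
Qed.

End continuous_integrals.

(** The neighbourhoods of [s] are the sets containing the preimage of an open neighbourhood of
    [f s]. *)
Lemma cvg_initial_topology (S : choiceType) (T : topologicalType) (f : S -> T)
    (F : set_system S) (FF : Filter F) (s : S) :
  F --> (s : initial_topology f) <-> f @ F --> f s.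
Proof.
split=> [Fs|Ffs].
  by apply: cvg_comp Fs _; exact: (@initial_continuous _ _ f).
move=> A /= [_ [[B Bop <-] Bfs sBfA]].
have FB : F (f @^-1` B) by apply: Ffs; apply: open_nbhs_nbhs; split.
exact: filterS sBfA FB.
Qed.

(** [weak_star] is initial for a map into the pointwise topology, itself a supremum of initial
    topologies, one for each test function. Hence [cvg_initial_topology] is used at both levels. *)
Lemma cvg_weak_starP {R : realType} {X : pmetricType R}
    (m : nat -> probability (borel X) R) (mu : probability (borel X) R) :
  (m n : weak_star X) @[n --> \oo] --> (mu : weak_star X) <->
  forall phi : X -> R[i], continuous phi ->
    cintegral (m n) phi @[n --> \oo] --> cintegral mu phi.
Proof.
split=> [/cvg_initial_topology /cvg_sup cvm phi cphi|cvm].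
  pose p : continuousType X R[i] :=
    HB.pack phi (@isContinuous.Build _ _ phi cphi).
  have := cvm p => /cvg_initial_topology; exact.
apply/cvg_initial_topology/cvg_sup => p; apply/cvg_initial_topology.
by apply: cvm; exact: (@cts_fun _ _ p).
Qed.

(** * The equivalence *)

Section implications.
Context {R : realType} {X : pmetricType R} (T : X -> X).
Hypotheses (cptX : compact [set: X]) (contT : continuous T).
Variable mu : probability (borel X) R.

Local Notation avg := (real_birkhoff_avg T).
Local Notation avg_cvg f x := (avg f n x @[n --> \oo] --> \int[mu]_z f z).

(** At a fixed [x], the continuous functions satisfying [avg_cvg] form a linear space closed under
    uniform limits; this carries convergence from a countable family to all continuous functions. *)
Lemma avg_cvgD (f g : X -> R) x : continuous f -> continuous g ->
  avg_cvg f x -> avg_cvg g x -> avg_cvg (fun z => f z + g z) x.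
Proof.
move=> cf cg fx gx; rewrite RintegralD//; [|exact: continuous_integrable..].
rewrite (_ : (fun n => avg _ n x) = (fun n => avg f n x + avg g n x)).
  exact: cvgD.
by apply/funext => n; rewrite /real_birkhoff_avg big_split mulrDr.
Qed.

Lemma avg_cvgZ (c : R) (f : X -> R) x : continuous f ->
  avg_cvg f x -> avg_cvg (fun z => c * f z) x.
Proof.
move=> cf fx; rewrite RintegralZl//; last exact: continuous_integrable.
rewrite (_ : (fun n => avg _ n x) = (fun n => c * avg f n x)).
  by apply: cvgM => //; exact: cvg_cst.
by apply/funext => n; rewrite /real_birkhoff_avg -mulr_sumr mulrCA.
Qed.

Lemma avg_cvg_sum (p : nat -> X -> R) (c : nat -> R) N x :
  (forall i, continuous (p i)) -> (forall i, avg_cvg (p i) x) ->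
  avg_cvg (fun z => \sum_(i < N) c i * p i z) x.
Proof.
move=> cp px.
have cc k : continuous (fun z => c k * p k z).
  by move=> z; apply: cvgM; [exact: cvg_cst|exact: cp].
elim: N => [|N IHN].
  under eq_Rintegral do rewrite big_ord0; rewrite Rintegral_cst// mul0r.
  rewrite (_ : (fun n => avg _ n x) = (fun=> 0)); first exact: cvg_cst.
  by apply/funext => n; rewrite /real_birkhoff_avg big1 ?mulr0// => i _; rewrite big_ord0.
have -> : (fun z => \sum_(i < N.+1) c i * p i z) =
    (fun z => \sum_(i < N) c i * p i z + c N * p N z).
  by apply/funext => z; rewrite big_ord_recr.
apply: avg_cvgD => //; last exact: avg_cvgZ.
by apply: continuous_big => [|i _]; [exact: add_continuous|exact: cc].
Qed.

Lemma avg_le (f g : X -> R) (e : R) n x : (forall z, f z <= g z + e) ->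
  0 <= e -> avg f n x <= avg g n x + e.
Proof.
(* At [n = 0] both averages are 0, and the claim is [0 <= e]. *)
move=> fg e0; case: n => [|n]; first by rewrite /real_birkhoff_avg invr0 !mul0r add0r.
rewrite /real_birkhoff_avg mulrC ler_pdivrMr// mulrDl mulrAC mulVf ?pnatr_eq0// mul1r.
rewrite (le_trans (ler_sum _ (fun i _ => fg _)))// big_split/= lerD2l.
by rewrite sumr_const card_ord mulr_natr.
Qed.

Lemma Rintegral_le (f g : X -> R) (e : R) : continuous f -> continuous g ->
  (forall z, f z <= g z + e) -> \int[mu]_z f z <= \int[mu]_z g z + e.
Proof.
move=> cf cg fg.
have -> : \int[mu]_z g z + e = \int[mu]_z (g z + e).
  rewrite RintegralD//; [|exact: continuous_integrable|].
    by rewrite Rintegral_cst// (congr1 fine (probability_setT mu)) mulr1.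
  by apply: (continuous_integrable cptX mu setT (fun=> e)) => // z; exact: cvg_cst.
apply: le_Rintegral => //; first exact: continuous_integrable.
apply: (continuous_integrable cptX mu setT (fun z => g z + e)) => // z.
by apply: cvgD; [exact: cg|exact: cvg_cst].
Qed.

Lemma avg_cvg_uniform_limit (f : X -> R) x : continuous f ->
  (forall e : R, 0 < e -> exists g : X -> R,
    [/\ continuous g, forall z, `|f z - g z| <= e & avg_cvg g x]) ->
  avg_cvg f x.
Proof.
move=> cf fg; apply/cvgrPdist_le => /= e e0.
(* One third for the averages, one for the integrals, one for the convergence at [g]. *)
have e30 : 0 < e / 3 by rewrite divr_gt0.
have [g [cg fge gx]] := fg _ e30.
have fle z : f z <= g z + e / 3.
  by have := fge z; rewrite ler_norml => /andP[_]; rewrite lerBlDl.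
have gle z : g z <= f z + e / 3.
  by have := fge z; rewrite distrC ler_norml => /andP[_]; rewrite lerBlDl.
have Ifg := Rintegral_le f g _ cf cg fle.
have Igf := Rintegral_le g f _ cg cf gle.
move/cvgrPdist_le : gx => /(_ _ e30); apply: filterS => n.
have := avg_le f g _ n x fle (ltW e30); have := avg_le g f _ n x gle (ltW e30).
rewrite !ler_norml => ? ? /andP[? ?]; apply/andP; split; lra.
Qed.

(** Null sets are discarded only for the countably many [p m i]; elsewhere convergence extends to
    every [f] at the same point, so [f] is quantified inside the almost everywhere clause. *)
Lemma ergodic_ae_cvg : ergodic T mu ->
  {ae mu, forall x, forall f : X -> R, continuous f -> avg_cvg f x}.
Proof.
move=> [invT ergT]; have [p [cp pP]] := continuous_separable cptX.
have mT := continuous_borel_map T contT.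
have : {ae mu, forall x, forall m i, avg_cvg (p m i) x}.
  apply: ae_foralln => m; apply: ae_foralln => i.
  have [C pC] := continuous_compact_bounded cptX _ (cp m i).
  apply: (birkhoff_avg_ae_cvg mu T mT invT ergT (p m i) C) => //.
  exact: continuous_measurable_borel.
apply: (@filterS (borel X) _ (ae_filter_ringOfSetsType mu)) => x px f cf.
apply: avg_cvg_uniform_limit => // e e0.
have [m [N [c fc]]] := pP f cf e e0.
exists (fun z => \sum_(i < N) c i * p m i z); split => //; last exact: avg_cvg_sum.
apply: continuous_big => [|i _]; first exact: add_continuous.
by move=> z; apply: cvgM; [exact: cvg_cst|exact: cp].
Qed.

(** The exceptional set is only known to lie in a Borel null set; the complement of the latter is a
    Borel choice of [Y]. *)
Lemma ae_full_set (P : X -> Prop) : {ae mu, forall x, P x} ->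
  exists Y : set (borel X), [/\ measurable Y, mu Y = 1%E & forall y, Y y -> P y].
Proof.
move=> [N [mN N0 PN]]; exists (~` N); split; first exact: measurableC.
  by rewrite probability_setC// N0 sube0.
by move=> y Ny; apply: contrapT => nP; apply: Ny; exact: PN.
Qed.

Lemma full_set_ae (P : X -> Prop) (Y : set (borel X)) :
  measurable Y -> mu Y = 1%E -> (forall y, Y y -> P y) -> {ae mu, forall x, P x}.
Proof.
move=> mY Y1 YP; exists (~` Y); split; first exact: measurableC.
  by rewrite probability_setC// Y1 subee.
by move=> x nP Yx; apply: nP; exact: YP.
Qed.

Lemma ae_exists (P : X -> Prop) : {ae mu, forall x, P x} -> exists x, P x.
Proof.
move=> /ae_full_set[Y [mY Y1 YP]]; apply: contrapT => nP.
suff Y0 : Y = set0 by move: Y1; rewrite Y0 measure0 => /eqP; rewrite eq_sym onee_eq0.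
by rewrite -subset0 => y /YP Py; apply: nP; exists y.
Qed.

(** * Deviation sets and almost everywhere convergence *)

Definition deviation_set (phi : X -> R[i]) (eps : R) (k : nat) : set (borel X) :=
  \bigcup_(n in [set n | (k <= n)%N])
     [set x | eps%:C < `| birkhoff_avg T phi n x - cintegral mu phi |].

Lemma measurable_deviation_set (phi : X -> R[i]) (eps : R) k :
  continuous phi -> 0 < eps -> measurable (deviation_set phi eps k).
Proof.
move=> /continuous_complexP[cR cI] eps0; apply: bigcup_measurable => n _.
(* Squaring the modulus turns the set into the preimage of an open ray under the continuous function
   [G]. *)
pose g (f : X -> R) x := (avg f n x - \int[mu]_z f z) ^+ 2.
have cg f : continuous f -> continuous (g f).
  move=> cf x.
  have cB : avg f n z - \int[mu]_z f z @[z --> x] --> avg f n x - \int[mu]_z f z.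
    by apply: cvgB; [exact: real_birkhoff_avg_continuous|exact: cvg_cst].
  exact: (cvgM cB cB).
pose G x := g (fun x => complex.Re (phi x)) x + g (fun x => complex.Im (phi x)) x.
rewrite [X in measurable X](_ : _ = G @^-1` `]eps ^+ 2, +oo[).
  apply: sub_sigma_algebra; apply: open_comp => [x _|]; last exact: interval_open.
  by apply: cvgD; exact: cg.
apply/seteqP; split=> x /=; rewrite in_itv/= andbT normc_def ltcR birkhoff_avgE /=.
  move=> h; have h0 : 0 <= G x by rewrite addr_ge0 ?sqr_ge0.
  rewrite -(sqr_sqrtr h0) ltr_pXn2r// nnegrE ?sqrtr_ge0// ltW//.
move=> h; rewrite -(ger0_norm (ltW eps0)) -sqrtr_sqr ltr_sqrt//.
by rewrite (le_lt_trans _ h)// sqr_ge0.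
Qed.

Lemma cvg_deviation_set (phi : X -> R[i]) (eps : R) :
  continuous phi -> 0 < eps ->
  mu (deviation_set phi eps k) @[k --> \oo] --> mu (\bigcap_k deviation_set phi eps k).
Proof.
move=> cphi eps0; apply: nonincreasing_cvg_mu.
- by rewrite (le_lt_trans (probability_le1 _ _)) ?ltry//; exact: measurable_deviation_set.
- by move=> k; exact: measurable_deviation_set.
- by apply: bigcap_measurable => // k _; exact: measurable_deviation_set.
- apply/nonincreasing_seqP => k; apply/subsetPset => x [n /= kn xn].
  by exists n => //=; exact: ltnW.
Qed.

(** A point in all the deviation sets deviates by more than [eps] for arbitrarily large [n], so it
    lies in the exceptional null set. *)
Lemma ae_cvg_deviation (phi : X -> R[i]) (eps : R) : continuous phi -> 0 < eps ->
  {ae mu, forall x, birkhoff_avg T phi n x @[n --> \oo] --> cintegral mu phi} ->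
  mu (deviation_set phi eps k) @[k --> \oo] --> 0%E.
Proof.
move=> cphi eps0 [N [mN N0 cvgN]].
suff <- : mu (\bigcap_k deviation_set phi eps k) = 0%E by exact: cvg_deviation_set.
apply/eqP; rewrite -measure_le0 -N0 le_measure ?inE//.
  by apply: bigcap_measurable => // k _; exact: measurable_deviation_set.
move=> x xE; apply: cvgN => /= /cvgrPdist_le/(_ eps%:C); rewrite (ltcR 0) => /(_ eps0).
move=> [k _ kx]; have [n /= kn] := xE k I; rewrite distrC.
by move=> /lt_le_trans/(_ (kx n kn)); rewrite ltxx.
Qed.

(** For each [eps] the intersection of the deviation sets is null by uniqueness of limits, and the
    countably many values [m.+1%:R^-1] of [eps] suffice. *)
Lemma deviation_ae_cvg (phi : X -> R[i]) : continuous phi ->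
  (forall eps : R, 0 < eps -> mu (deviation_set phi eps k) @[k --> \oo] --> 0%E) ->
  {ae mu, forall x, birkhoff_avg T phi n x @[n --> \oo] --> cintegral mu phi}.
Proof.
move=> cphi dev0.
have m0 m : 0 < m.+1%:R^-1 :> R by rewrite invr_gt0.
have : {ae mu, forall x, forall m : nat,
    ~ (\bigcap_k deviation_set phi m.+1%:R^-1 k) x}.
  apply: ae_foralln => m; exists (\bigcap_k deviation_set phi m.+1%:R^-1 k); split.
  - by apply: bigcap_measurable => // k _; exact: measurable_deviation_set.
  - exact: (cvg_unique _ (cvg_deviation_set phi _ cphi (m0 m)) (dev0 _ (m0 m))).
  - by move=> x /= /contrapT.
apply: filterS => x xm; apply/cvgrPdist_le => /= e e0.
have /complex_realP[r er] := gtr0_real e0.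
rewrite er (ltcR 0) in e0; rewrite {}er.
have [m mr] : exists m, m.+1%:R^-1 <= r.
  exists (Num.truncn r^-1); rewrite -[leRHS]invrK lef_pV2 ?posrE ?invr_gt0//.
  by rewrite ltW// truncnS_gt.
have /existsNP[k /not_implyP[_ xk]] := xm m.
exists k => // n /= kn; rewrite distrC.
have : ~ (m.+1%:R^-1)%:C < `|birkhoff_avg T phi n x - cintegral mu phi|.
  by move=> h; apply: xk; exists n.
rewrite normc_def => /negP; rewrite ltcR -leNgt => h; rewrite lecR; exact: le_trans mr.
Qed.

(** * From almost everywhere convergence to ergodicity *)

Section converse.
Hypothesis ae_cvg : forall f : X -> R, continuous f -> {ae mu, forall x, avg_cvg f x}.

(** The difference of the averages of [f \o T] and [f] telescopes to [(f (iter n T x) - f x) / n],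
    which tends to 0. A single point where both averages converge is enough, and one exists since
    [mu] has mass 1. *)
Lemma Rintegral_comp_eq (f : X -> R) : continuous f ->
  \int[mu]_x f (T x) = \int[mu]_x f x.
Proof.
move=> cf; have cfT : continuous (f \o T).
  by move=> x; apply: continuous_comp; [exact: contT|exact: cf].
have [C fC] := continuous_compact_bounded cptX f cf.
have [x [fx fTx]] : exists x, avg_cvg f x /\ avg_cvg (f \o T) x.
  apply: ae_exists; apply: (@filterS2 (borel X) _ (ae_filter_ringOfSetsType mu))
    (ae_cvg f cf) (ae_cvg _ cfT) => x; by split.
have d0 : avg (f \o T) n x - avg f n x @[n --> \oo] --> (0 : R).
  have dE n : avg (f \o T) n x - avg f n x = n%:R^-1 * (f (iter n T x) - f x).
    rewrite /real_birkhoff_avg -mulrBr; congr (_ * _).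
    rewrite -sumrB -(big_mkord xpredT (fun i => f (T (iter i T x)) - f (iter i T x))).
    by rewrite (telescope_sumr (fun i => f (iter i T x)) (leq0n n)).
  apply/cvgrPdist_le => /= e e0; exists (Num.truncn ((2 * C) / e)).+1 => // n /= Cn.
  have n0 : 0 < n%:R :> R by rewrite ltr0n (leq_ltn_trans _ Cn).
  rewrite sub0r normrN dE normrM ger0_norm ?invr_ge0 ?ler0n// mulrC ler_pdivrMr//.
  rewrite (le_trans (ler_normB _ _))// (le_trans (lerD (fC _) (fC _)))//.
  rewrite -mulr2n -[C *+ 2]mulr_natl [leRHS]mulrC -ler_pdivrMr//.
  by rewrite (le_trans (ltW (truncnS_gt _)))// ler_nat.
apply/eqP; rewrite -subr_eq0; apply/eqP.
exact: (cvg_unique _ (cvgB fTx fx) d0).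
Qed.

(** Open sets are stable under intersection and generate the Borel sets, so [mu] and its pushforward
    need only be compared on them, by approximating indicators with continuous functions. *)
Lemma invariant_of_ae_cvg : invariant_measure T mu.
Proof.
have mT := continuous_borel_map T contT.
move=> B mB; rewrite -[LHS]/(pushforward mu (T : borel X -> borel X) B).
apply: (@measure_unique _ R (borel X) (@open X) (fun=> setT) _ _ _ _
  (pushforward mu (T : borel X -> borel X)) mu) => //.
- by move=> U V; exact: openI.
- by move=> _; exact: openT.
- by rewrite bigcup_const//; exists 0%N.
- move=> U oU; rewrite /pushforward.
  have mU : measurable (U : set (borel X)) by exact: sub_sigma_algebra.
  have mTU : measurable (T @^-1` U : set (borel X)).
    by rewrite -[X in measurable X]setTI; exact: mT.
  have [g [cg g01 gU]] := open_indic_approx U oU.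
  have mg k := continuous_measurable_borel _ (cg k).
  have := cvg_Rintegral_indic mu setT U g measurableT mU mg g01 gU.
  have := cvg_Rintegral_indic mu setT (T @^-1` U) (fun k => g k \o T) measurableT mTU
    (fun k => measurableT_comp (mg k) mT) (fun k x => g01 k (T x)) (fun x => gU (T x)).
  under eq_fun do rewrite /= Rintegral_comp_eq//.
  rewrite !setIT => h1 h2; rewrite -[LHS]fineK ?fin_num_measure//.
  by rewrite -[RHS]fineK ?fin_num_measure// (cvg_unique _ h1 h2).
- by move=> _; exact: (le_lt_trans (probability_le1 mu measurableT) (ltry 1)).
Qed.

(** Supplies the constant that dominates the averages when they are integrated over an invariant
    set. *)
Lemma norm_avg_le (f : X -> R) (C : R) n x : (forall z, `|f z| <= C) ->
  `|avg f n x| <= C.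
Proof.
move=> fC; have C0 : 0 <= C by exact: le_trans (fC x).
case: n => [|n]; first by rewrite /real_birkhoff_avg big_ord0 mulr0 normr0.
rewrite /real_birkhoff_avg normrM ger0_norm ?invr_ge0// mulrC ler_pdivrMr//.
rewrite (le_trans (ler_norm_sum _ _ _))// (le_trans (ler_sum _ (fun i _ => fC _)))//.
by rewrite sumr_const card_ord mulr_natr.
Qed.

(* For T^-1 B = B, integrating the averages of f over B gives on the one hand
   the integral of f over B, on the other hand mu B times that of f. So
   mu (A `&` B) = mu B * mu A for open A, hence for A = B. *)
Lemma ergodic_of_ae_cvg : ergodic T mu.
Proof.
have invT := invariant_of_ae_cvg; split=> // B mB TB.
have mT := continuous_borel_map T contT.
have IB (f : X -> R) : continuous f ->
    \int[mu]_(x in B) f x = \int[mu]_x f x * fine (mu B).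
  move=> cf; have [C fC] := continuous_compact_bounded cptX f cf.
  have iB i : \int[mu]_(x in B) f (iter i T x) = \int[mu]_(x in B) f x.
    elim: i => // i IHi; rewrite -IHi.
    have cfi : continuous (f \o iter i T).
      by move=> x; apply: continuous_comp; [exact: continuous_iter|exact: cf].
    rewrite -[RHS](Rintegral_comp_invariant mu T mT invT B (f \o iter i T) C) ?TB//.
    - by under [RHS]eq_Rintegral do rewrite /= -iterSr.
    - exact: continuous_measurable_borel.
    - by move=> x; exact: fC.
  have sB n : \int[mu]_(x in B) (\sum_(i < n) f (iter i T x)) =
      n%:R * \int[mu]_(x in B) f x.
    elim: n => [|n IHn].
      by under eq_Rintegral do rewrite big_ord0; rewrite Rintegral_cst// !mul0r.
    under eq_Rintegral do rewrite big_ord_recr/=.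
    rewrite RintegralD//; last 2 first.
    + apply: (continuous_integrable cptX) => //; apply: continuous_big => [|i _].
        exact: add_continuous.
      by move=> x; apply: continuous_comp; [exact: continuous_iter|exact: cf].
    + apply: (continuous_integrable cptX mu B (fun x => f (iter n T x))) => // x.
      by apply: continuous_comp; [exact: continuous_iter|exact: cf].
    by rewrite IHn iB -[in RHS]natr1 mulrDl mul1r.
  (* The index is shifted because the average at index 0 is 0, whatever the integral of [f] over
     [B]. *)
  have aB n : \int[mu]_(x in B) avg f n.+1 x = \int[mu]_(x in B) f x.
    rewrite /real_birkhoff_avg RintegralZl// ?sB ?mulKf ?pnatr_eq0//.
    apply: (continuous_integrable cptX) => //; apply: continuous_big => [|i _].
      exact: add_continuous.
    by move=> x; apply: continuous_comp; [exact: continuous_iter|exact: cf].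
  pose I : R := \int[mu]_x f x; rewrite -/I.
  have mavg n : measurable_fun B (EFin \o avg f n.+1).
    apply/measurable_EFinP; apply: measurable_funTS.
    by apply: continuous_measurable_borel; exact: real_birkhoff_avg_continuous.
  have mI : measurable_fun B (EFin \o cst I).
    by apply/measurable_EFinP; exact: measurable_cst.
  have iC : mu.-integrable B (cst C%:E).
    by apply: (bounded_integrable mu B (cst C) `|C|) => //; exact: measurable_cst.
  have avgI : {ae mu, forall x, B x ->
      (EFin \o avg f n.+1) x @[n --> \oo] --> (EFin \o cst I) x}.
    apply: (@filterS (borel X) _ (ae_filter_ringOfSetsType mu)) (ae_cvg f cf) => x fx _.
    apply: cvg_EFin; first exact: nearW.
    by move: fx; rewrite -(cvg_shiftS (fun n => avg f n x)).
  have avgC x n : B x -> (`|(EFin \o avg f n.+1) x| <= C%:E)%E.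
    by move=> _; rewrite lee_fin norm_avg_le.
  have [_ _] := dominated_convergence mB mavg mI avgI iC (aeW _ avgC).
  have -> : (\int[mu]_(x in B) (EFin \o cst I) x)%E = (I * fine (mu B))%:E.
    rewrite -[LHS]/(\int[mu]_(x in B) cst I%:E x)%E.
    by rewrite integral_cst// EFinM (@fineK _ (mu B)) ?fin_num_measure.
  move=> /fine_cvg h.
  have : fine \o [sequence (\int[mu]_(x in B) (EFin \o avg f n.+1) x)%E]_n @ \oo -->
      \int[mu]_(x in B) f x.
    by apply: cvg_near_cst; apply: nearW => n; exact: aB.
  by move=> h'; exact: (cvg_unique _ h' h).
have UB (A : set (borel X)) : measurable A ->
    mu (A `&` B) = ((fine (mu B))%:E * mu A)%E.
  move=> mA; pose b : {nonneg R} := NngNum (fine_ge0 (measure_ge0 mu B)).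
  (* Both sides are finite measures in [A], so agreement on open sets is enough. *)
  apply: (@measure_unique _ R (borel X) (@open X) (fun=> setT) _ _ _ _
    (mrestr mu mB) (mscale b mu)) => //.
  - by move=> U V; exact: openI.
  - by move=> _; exact: openT.
  - by rewrite bigcup_const//; exists 0%N.
  - move=> U oU; rewrite /mrestr /mscale /=.
    have mU : measurable (U : set (borel X)) by exact: sub_sigma_algebra.
    have [g [cg g01 gU]] := open_indic_approx U oU.
    have mg k := continuous_measurable_borel _ (cg k).
    have := cvg_Rintegral_indic mu B U g mB mU mg g01 gU.
    have := cvg_Rintegral_indic mu setT U g measurableT mU mg g01 gU.
    under [X in _ -> X @ _ --> _ -> _]eq_fun do rewrite IB//.
    rewrite setIT => h1 h2.
    have h3 : (\int[mu]_x g k x) * fine (mu B) @[k --> \oo] -->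
        fine (mu U) * fine (mu B) by apply: cvgM => //; exact: cvg_cst.
    have e : fine (mu U) * fine (mu B) = fine (mu (U `&` B)) .
      exact: (cvg_unique _ h3 h2).
    have mUB : measurable (U `&` B : set (borel X)) by exact: measurableI.
    rewrite -[LHS]/(mu (U `&` B)) -[RHS]/((fine (mu B))%:E * mu U)%E.
    rewrite -(@fineK _ (mu (U `&` B))) ?fin_num_measure// -e EFinM muleC.
    by rewrite (@fineK _ (mu U)) ?fin_num_measure.
  - move=> _; have mTB := measurableI _ _ (@measurableT _ (borel X)) mB.
    exact: (le_lt_trans (probability_le1 mu mTB) (ltry 1)).
(* With [A = B], the number [mu B] equals its own square. *)
have := UB B mB; rewrite setIid -[in X in X = _ -> _](@fineK _ (mu B)) ?fin_num_measure//.
rewrite -[X in (_ * X)%E](@fineK _ (mu B)) ?fin_num_measure// -EFinM => -[bb].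
rewrite -(@fineK _ (mu B)) ?fin_num_measure//.
have /eqP : fine (mu B) * (1 - fine (mu B)) = 0 by rewrite mulrBr mulr1 -bb subrr.
by rewrite mulf_eq0 subr_eq0 => /orP[/eqP ->|/eqP <-]; [left|right].
Qed.

End converse.
End implications.

Theorem lemma3p1 (R : realType) (X : pmetricType R) (T : X -> X)
    (cptX : compact [set: X]) (contT : continuous T)
    (mu : probability (borel X) R) :
  [<->
    (* 1 *) ergodic T mu;
    (* 2 *) exists Y : set (borel X),
      [/\ measurable Y, mu Y = 1%E &
        forall y, Y y ->
          (empirical T y n : weak_star X) @[n --> \oo] --> (mu : weak_star X)];
    (* 3 *) exists Y : set (borel X),
      [/\ measurable Y, mu Y = 1%E &
        forall y, Y y -> forall phi : X -> R[i], continuous phi ->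
          birkhoff_avg T phi n y @[n --> \oo] --> cintegral mu phi];
    (* 4 *) forall phi : X -> R[i], continuous phi ->
      forall eps : R, 0 < eps ->
        mu (\bigcup_(n in [set n | (k <= n)%N])
              [set x | eps%:C < `| birkhoff_avg T phi n x - cintegral mu phi |])
          @[k --> \oo] --> 0%E;
    (* 5 *) forall phi : X -> R[i], continuous phi ->
      {ae mu, forall x,
        birkhoff_avg T phi n x @[n --> \oo] --> cintegral mu phi}].
Proof.
tfae.
- move=> erg.
  have [Y [mY Y1 YP]] := ae_full_set mu _ (ergodic_ae_cvg T cptX contT mu erg).
  exists Y; split => // y Yy; apply/cvg_weak_starP => phi cphi.
  have /continuous_complexP[cR cI] := cphi.
  under eq_fun do rewrite empirical_cintegral//.
  apply/(cvg_complex_shiftS (fun n => birkhoff_avg T phi n y)).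
  by apply/cvg_birkhoff_avgP; split; exact: YP.
- move=> [Y [mY Y1 YP]]; exists Y; split => // y Yy phi cphi.
  have /cvg_weak_starP/(_ phi cphi) := YP y Yy.
  under eq_fun do rewrite empirical_cintegral//.
  by move=> /(cvg_complex_shiftS (fun n => birkhoff_avg T phi n y)).
- move=> [Y [mY Y1 YP]] phi cphi eps eps0.
  apply: (ae_cvg_deviation T contT mu) => //.
  by apply: (full_set_ae mu _ Y) => // y Yy; exact: YP.
- move=> dev phi cphi; apply: deviation_ae_cvg => // eps eps0.
  exact: dev.
- move=> ae_cvg; apply: ergodic_of_ae_cvg => // f cf.
  (* The hypothesis concerns complex functions: a real [f] is given zero imaginary part, and the
     real part of the limit is read off. *)
  have cfC : continuous (fun x => (f x)%:C).
    by apply/continuous_complexP; split => // x; exact: cvg_cst.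
  apply: (@filterS (borel X) _ (ae_filter_ringOfSetsType mu)) (ae_cvg _ cfC) => x.
  by move=> /cvg_birkhoff_avgP[].
Qed.
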